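(* Let $n\geq 4$ be an integer and let $P_n$ denote the path on $n$ vertices. Then $\rho(P_n)=3$ if $n\leq 21$, and $\rho(P_n)=4$ if $n\geq 22$.
   Context: All graphs are finite, simple and undirected. A $k$-coloring of a graph $G$ is a function $c\colon V(G)\to\{1,\dots,k\}$. A walk in $G$ is a sequence $v_1\cdots v_r$ of vertices with $v_iv_{i+1}\in E(G)$ for all $i\in\{1,\dots,r-1\}$. A sequence $a_1\cdots a_{2t}$ is repetitive if $a_i=a_{i+t}$ for all $i\in\{1,\dots,t\}$. A walk $v_1\cdots v_{2t}$ is a stroll if $v_i\neq v_{i+t}$ for every $i\in\{1,\dots,t\}$. A coloring $c$ is stroll-nonrepetitive if for no stroll $v_1\cdots v_{2t}$ is the sequence $c(v_1)\cdots c(v_{2t})$ repetitive. The stroll-nonrepetitive chromatic number $\rho(G)$ is the minimum $k$ such that $G$ has a stroll-nonrepetitive $k$-coloring. *)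

(* Defs.v *)
From mathcomp Require Import all_boot.
From mathcomp Require Import boolp.

Set Implicit Arguments.
Unset Strict Implicit.
Unset Printing Implicit Defensive.

Record sgraph := SGraph {
  vertex :> finType;
  edge : rel vertex;
  edge_sym : symmetric edge;
  edge_irrefl : irreflexive edge }.

(* Colors are 0, ..., k - 1 instead of 1, ..., k. *)
Definition coloring (G : sgraph) (k : nat) := G -> 'I_k.

(* A walk has at least one vertex; this is what excludes the empty sequence,
   which would otherwise be a stroll with a repetitive color sequence. *)
Definition walk (G : sgraph) (w : seq G) : Prop :=
  w <> [::] /\ sorted (@edge G) w.

(* Positions are counted from 0, and [onth s i] is [Some] of the i-th entry of
   s because every position used is smaller than the size of s. *)
Definition repetitive (T : Type) (s : seq T) : Prop :=
  exists t, size s = (2 * t)%N /\ forall i, i < t -> onth s i = onth s (i + t).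

Definition stroll (G : sgraph) (w : seq G) : Prop :=
  walk w /\
  exists t, size w = (2 * t)%N /\ forall i, i < t -> onth w i <> onth w (i + t).

Definition stroll_nonrepetitive (G : sgraph) (k : nat) (c : coloring G k) :
  Prop :=
  forall w : seq G, stroll w -> ~ repetitive [seq c v | v <- w].

Definition stroll_colorable (G : sgraph) (k : nat) : Prop :=
  exists c : coloring G k, stroll_nonrepetitive c.

Lemma stroll_colorable_exists (G : sgraph) :
  exists k, `[< stroll_colorable G k >].
Proof.
exists #|G|; apply/asboolP; exists (@enum_rank G) => w.
move=> [[w0 _] [t [szw neq_w]]] [t' [szcw eq_cw]].
have t't : t' = t.
  by move: szcw; rewrite size_map szw => /eqP; rewrite eqn_mul2l /= => /eqP.
have t_gt0 : 0 < t.
  by case: t szw {neq_w t't} => // /eqP; rewrite muln0 size_eq0 => /eqP.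
apply: (neq_w 0 t_gt0).
have := eq_cw 0; rewrite t't => /(_ t_gt0).
rewrite !onth_map; case: (onth w 0) (onth w (0 + t)) => [x|] [y|] //=.
by move=> [/enum_rank_inj ->].
Qed.

Definition rho (G : sgraph) : nat := ex_minn (stroll_colorable_exists G).

Definition path_adj (n : nat) : rel 'I_n :=
  fun i j => (i.+1 == j :> nat) || (j.+1 == i :> nat).

Lemma path_adj_sym n : symmetric (@path_adj n).
Proof. by move=> i j; rewrite /path_adj orbC. Qed.

Lemma path_adj_irrefl n : irreflexive (@path_adj n).
Proof. by move=> i; rewrite /path_adj orbb eqn_leq ltnn. Qed.

Definition path_graph (n : nat) : sgraph :=
  SGraph (@path_adj_sym n) (@path_adj_irrefl n).

(* Main.v *)
(** A repetitive stroll amounts to two equally long color-preserving walks [a]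
    and [b] that are never at the same vertex at the same time, with [b]
    starting next to the end of [a].

    Four colors: take a square-free ternary word (differences of the Thue-Morse
    word) and insert a fourth letter after every second letter; the result is
    square-free and has no factor [xyx].  Then the color of the next vertex
    determines the direction of a step, so [a] and [b] either move in parallel,
    and [a] sweeps a full period of a square, or they are mirror images, and
    must cross.

    Three colors: on 21 vertices an explicit word works, which is checked by
    exploring the graph of pairs of distinct vertices of equal color.  On 22
    vertices a backtracking search shows that one of twelve strolls is always
    repetitive. *)

Require Import Defs.
From mathcomp Require Import all_boot.
From mathcomp Require Import boolp zify.

Set Implicit Arguments.
Unset Strict Implicit.
Unset Printing Implicit Defensive.

(** * Reduction to pairs of walks and to colorings of the natural numbers *)

Lemma all2_nthP (S T : Type) (x0 : S) (y0 : T) (r : S -> T -> bool) s t :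
  reflect
    (size s = size t /\ forall i, i < size s -> r (nth x0 s i) (nth y0 t i))
    (all2 r s t).
Proof.
rewrite all2E; apply: (iffP andP) => [[/eqP sz_st /(all_nthP (x0, y0)) r_st]|].
  split=> // i lt_i.
  have := r_st i; rewrite size_zip -sz_st minnn => /(_ lt_i).
  by rewrite nth_zip.
move=> [sz_st r_st]; split; first exact/eqP.
apply/(all_nthP (x0, y0)) => i; rewrite size_zip -sz_st minnn => lt_i.
by rewrite nth_zip //=; apply: r_st.
Qed.

Lemma stroll_nonrepetitiveP (G : sgraph) k (c : coloring G k) :
  stroll_nonrepetitive c <->
  forall a b : seq G, a != [::] -> sorted (@edge G) (a ++ b) ->
    ~~ all2 (fun x y => (x != y) && (c x == c y)) a b.
Proof.
have onthS (T : Type) (z : T) u i : i < size u -> onth u i = Some (nth z u i).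
  by elim: u i => [|v u IHu] [|i] //=; apply: IHu.
split=> [Hc [//|x a] b _ ab_walk|Hc w [[w0 w_walk] [t [szw neq_w]]]].
  apply/negP => /(all2_nthP x x)[sz_ab ab_eq].
  have szw : size ((x :: a) ++ b) = 2 * size (x :: a).
    by rewrite size_cat -sz_ab mul2n addnn.
  have onth_b i : onth ((x :: a) ++ b) (i + size (x :: a)) = onth b i.
    by rewrite onth_cat ltnNge leq_addl /= addnK.
  apply: (Hc ((x :: a) ++ b)).
    split=> //; exists (size (x :: a)); split=> // i lt_i.
    rewrite onth_b onth_cat lt_i !(onthS _ x) -?sz_ab // => -[eq_i].
    by have := ab_eq i lt_i; rewrite eq_i eqxx.
  exists (size (x :: a)); rewrite size_map; split=> // i lt_i.
  rewrite !onth_map onth_b onth_cat lt_i !(onthS _ x) -?sz_ab //=.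
  by have /andP[_ /eqP ->] := ab_eq i lt_i.
move=> [t' []]; rewrite size_map szw => /eqP; rewrite eqn_mul2l /= => /eqP <-.
move=> eq_cw; have [x _] : exists x : G, x \in w.
  by case: (w) w0 => // x u; exists x; apply: mem_head.
have t_gt0 : 0 < t by case: (w) w0 szw => //= ? ? _; lia.
have le_tw : t <= size w by lia.
suff: all2 (fun x y => (x != y) && (c x == c y)) (take t w) (drop t w).
  apply/negP; apply: Hc; last by rewrite cat_take_drop.
  by rewrite -size_eq0 size_takel //; lia.
apply/(all2_nthP x x); rewrite size_takel // size_drop; split; first lia.
move=> i lt_i; rewrite nth_take // nth_drop (addnC t).
have := neq_w i lt_i; have := eq_cw i lt_i.
rewrite !onth_map !(onthS _ x) ?(leq_trans lt_i) //=; try lia.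
by case=> -> neq; rewrite eqxx andbT; apply/eqP => eq_i; apply: neq; rewrite eq_i.
Qed.

Definition adj : rel nat := fun i j => (i.+1 == j) || (j.+1 == i).

Definition twin (f : nat -> nat) : rel nat :=
  fun x y => (x != y) && (f x == f y).

(** Colors are given on all natural numbers, so that one infinite word serves every [n]; only
    vertices below [n] are constrained. *)
Definition nonrep (n : nat) (f : nat -> nat) : Prop :=
  forall a b : seq nat, a != [::] -> all (gtn n) (a ++ b) ->
    sorted adj (a ++ b) -> ~~ all2 (twin f) a b.

Lemma stroll_colorable_pathP n k :
  stroll_colorable (path_graph n) k <->
  exists f : nat -> nat, (forall i, i < n -> f i < k) /\ nonrep n f.
Proof.
pose val_n (a : seq (path_graph n)) : seq nat := map (@nat_of_ord n) a.
have adjE a b : sorted adj (val_n a ++ val_n b) = sorted (@path_adj n) (a ++ b).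
  by rewrite -map_cat sorted_map.
have twinE (c : coloring (path_graph n) k) (f : nat -> nat) :
    (forall i : 'I_n, c i = f i :> nat) ->
    forall a b, all2 (twin f) (val_n a) (val_n b) =
      all2 (fun x y => (x != y) && (c x == c y)) a b.
  move=> cf; elim=> [|x a IHa] [|y b] //=; rewrite IHa /twin.
  by congr (_ && _ && _); rewrite -cf -cf.
have ordS a : all (gtn n) a -> exists a', a = val_n a'.
  elim: a => [|x a IHa] /=; first by exists [::].
  by move=> /andP[lt_xn /IHa[a' ->]]; exists (Ordinal lt_xn :: a').
split=> [[c /stroll_nonrepetitiveP Hc]|[f [f_lt Hf]]].
  pose f i := if insub i : option 'I_n is Some j then c j : nat else 0.
  have cf i : c i = f i :> nat by rewrite /f valK.
  exists f; split=> [i lt_in|a b a0].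
    by rewrite (_ : i = Ordinal lt_in) // -cf.
  rewrite all_cat => /andP[/ordS[a' Ea] /ordS[b' Eb]].
  rewrite Ea Eb adjE (twinE _ _ cf) => ab_walk; apply: Hc => //.
  by move: a0; rewrite Ea; case: (a').
pose c : coloring (path_graph n) k := fun i => Ordinal (f_lt i (ltn_ord i)).
exists c; apply/stroll_nonrepetitiveP => a b a0 ab_walk.
rewrite -(twinE c f) //; apply: Hf; last by rewrite adjE.
  by case: (a) a0.
by rewrite -map_cat all_map; apply/allP => i _ /=.
Qed.

Lemma nonrep_leq m n f : m <= n -> nonrep n f -> nonrep m f.
Proof.
move=> le_mn Hf a b a0 ab_lt; apply: Hf => //.
by apply: sub_all ab_lt => i /= /leq_trans; apply.
Qed.

Lemma rho_path_eq n k :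
  (exists f : nat -> nat, (forall i, i < n -> f i < k.+1) /\ nonrep n f) ->
  (forall f : nat -> nat, (forall i, i < n -> f i < k) -> ~ nonrep n f) ->
  rho (path_graph n) = k.+1.
Proof.
move=> /stroll_colorable_pathP col_k1 ncol_k; rewrite /rho.
case: ex_minnP => m /asboolP/stroll_colorable_pathP[f [f_lt Hf]].
move=> /(_ k.+1 (asboolT col_k1)); rewrite leq_eqVlt => /predU1P[//|lt_mk].
by case: (ncol_k f) => // i /f_lt lt_fi; apply: leq_trans lt_fi _.
Qed.

(** * Lower bounds *)

(** Adjacent vertices differ, so two colors must alternate, and the whole path is then a repetitive
    stroll. *)
Lemma nonrep4_gt2 (f : nat -> nat) : (forall i, i < 4 -> f i < 2) -> ~ nonrep 4 f.
Proof.
move=> f_lt Hf.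
have := Hf [:: 0] [:: 1] isT isT isT; have := Hf [:: 1] [:: 2] isT isT isT.
have := Hf [:: 2] [:: 3] isT isT isT.
have := Hf [:: 0; 1] [:: 2; 3] isT isT isT.
have := f_lt 0 isT; have := f_lt 1 isT; have := f_lt 2 isT; have := f_lt 3 isT.
rewrite /twin /= !andbT.
by case: (f 0) => [|[|?]] //; case: (f 1) => [|[|?]] //;
  case: (f 2) => [|[|?]] //; case: (f 3) => [|[|?]].
Qed.

(* Found by computer. Each stroll is given by its two halves, as offsets from
   its leftmost vertex. *)
Definition strolls22 : seq (seq nat * seq nat) :=
  [:: ([:: 1], [:: 0]);
      ([:: 3; 2], [:: 1; 0]);
      ([:: 5; 4; 3], [:: 2; 1; 0]);
      ([:: 7; 6; 5; 4], [:: 3; 2; 1; 0]);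
      ([:: 6; 5; 4; 3], [:: 2; 1; 0; 1]);
      ([:: 9; 8; 7; 6; 5; 4], [:: 3; 2; 1; 0; 1; 2]);
      ([:: 11; 10; 9; 8; 7; 6], [:: 5; 4; 3; 2; 1; 0]);
      ([:: 10; 9; 8; 7; 6; 5], [:: 4; 3; 2; 1; 0; 1]);
      ([:: 14; 13; 12; 11; 10; 9; 8; 7], [:: 6; 5; 4; 3; 2; 1; 0; 1]);
      ([:: 15; 14; 13; 12; 11; 10; 9; 8], [:: 7; 6; 5; 4; 3; 2; 1; 0]);
      ([:: 13; 12; 11; 10; 9; 8; 7; 6], [:: 5; 4; 3; 2; 1; 0; 1; 2]);
      ([:: 12; 11; 10; 9; 8; 7; 6; 5], [:: 4; 3; 2; 1; 0; 1; 2; 3])].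

Definition repeats (w : seq nat) (p : seq nat * seq nat) : bool :=
  [&& p.1 != [::], all (gtn (size w)) (p.1 ++ p.2), sorted adj (p.1 ++ p.2)
    & all2 (twin (nth 0 w)) p.1 p.2].

(** [w] colors the last vertices and grows to the left while [m] vertices remain uncolored. Strolls
    are tested with their leftmost vertex at the newest one; placements further right were tested
    earlier. *)
Fixpoint search (m : nat) (w : seq nat) : bool :=
  has (repeats w) strolls22 ||
  (if m is m'.+1 then all (fun x => search m' (x :: w)) (iota 0 3) else false).

Lemma nonrep_repeats n (f : nat -> nat) m w p :
  nonrep n f -> m + size w <= n -> (forall i, i < size w -> nth 0 w i = f (m + i)) ->
  ~~ repeats w p.
Proof.
case: p => a b Hf le_mn w_f; apply/and4P => /= -[a0 ab_lt ab_walk ab_twin].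
suff: all2 (twin f) (map (addn m) a) (map (addn m) b).
  apply/negP; apply: Hf; rewrite -?map_cat; first by case: (a) a0.
    by rewrite all_map; apply: sub_all ab_lt => i /= lt_i; lia.
  by rewrite sorted_map; apply: sub_sorted ab_walk => i j; rewrite /adj /=; lia.
have /(all2_nthP 0 0)[sz_ab twin_ab] := ab_twin.
apply/(all2_nthP 0 0); rewrite !size_map; split=> // i lt_i.
have := twin_ab i lt_i; move: ab_lt; rewrite all_cat => /andP[].
move=> /(all_nthP 0)/(_ i lt_i) lt_a /(all_nthP 0)/(_ i) lt_b.
rewrite !(nth_map 0) -?sz_ab // /twin !w_f ?eqn_add2l //.
by apply: lt_b; rewrite -sz_ab.
Qed.

Lemma searchP (f : nat -> nat) m w :
  (forall i, i < m + size w -> f i < 3) ->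
  (forall i, i < size w -> nth 0 w i = f (m + i)) ->
  search m w -> ~ nonrep (m + size w) f.
Proof.
elim: m w => [|m IHm] w f_lt w_f /orP[/hasP[p _]|] //.
- by move=> w_p Hf; have := nonrep_repeats p Hf (leqnn _) w_f; rewrite w_p.
- by move=> w_p Hf; have := nonrep_repeats p Hf (leqnn _) w_f; rewrite w_p.
move/allP/(_ (f m)); rewrite mem_iota f_lt ?addSn ?ltnS ?leq_addr // => /(_ isT).
move/IHm; rewrite /= addnS; apply=> [i|[|i] /=]; first exact: f_lt.
  by rewrite addn0.
by rewrite ltnS addnS -addSn; apply: w_f.
Qed.

Lemma nonrep22_gt3 (f : nat -> nat) :
  (forall i, i < 22 -> f i < 3) -> ~ nonrep 22 f.
Proof. by move=> f_lt; apply: (@searchP f 22 [::]) => //; vm_compute. Qed.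

(** * Three colors on 21 vertices *)

Lemma pair_path_invariant (f : nat -> nat) n (S : pred (nat * nat)) x y a b :
  (forall u v u' v', S (u, v) -> adj u u' -> adj v v' -> u' < n -> v' < n ->
     twin f u' v' -> S (u', v')) ->
  all (gtn n) a -> all (gtn n) b -> path adj x a -> path adj y b ->
  all2 (twin f) a b -> S (x, y) -> S (last x a, last y b).
Proof.
move=> S_step; elim: a b x y => [|u a IHa] [|v b] x y //=.
move=> /andP[lt_u lt_a] /andP[lt_v lt_b] /andP[xu a_walk] /andP[yv b_walk].
move=> /andP[uv ab_twin] Sxy; apply: IHa => //; exact: (S_step x y).
Qed.

Definition word21 : seq nat :=
  [:: 0; 1; 0; 2; 0; 1; 2; 1; 0; 2; 1; 2; 0; 1; 2; 1; 0; 2; 0; 1; 0].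

Definition color21 (i : nat) : nat := nth 0 word21 i.

(** At vertex 0 [.-1] yields a spurious stationary move; the extra pairs only make the check in
    [separated] stricter. *)
Definition pair_next (p : nat * nat) : seq (nat * nat) :=
  [seq q <- allpairs pair [:: p.1.+1; p.1.-1] [:: p.2.+1; p.2.-1] |
    [&& q.1 < 21, q.2 < 21 & twin color21 q.1 q.2]].

Fixpoint explore (fuel : nat) (seen todo : seq (nat * nat)) : seq (nat * nat) :=
  if fuel is fuel'.+1 then
    if todo is p :: todo' then
      if p \in seen then explore fuel' seen todo'
      else explore fuel' (p :: seen) (pair_next p ++ todo')
    else seen
  else seen.

(** A certificate checked after the search, so that nothing has to be proved about [explore]. The
    last condition keeps the end of the first walk from being next to the start of the second. *)
Definition separated (p : nat * nat) (s : seq (nat * nat)) : bool :=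
  [&& p \in s, all (fun q => all (mem s) (pair_next q)) s
    & all (fun q => ~~ adj q.1 p.2) s].

Lemma color21_separated x y : x < 21 -> y < 21 -> twin color21 x y ->
  exists s, separated (x, y) s.
Proof.
(* No pair reaches more than 30 pairs, and each has at most 4 successors. *)
pose P p := twin color21 p.1 p.2 ==> separated p (explore 121 [::] [:: p]).
have /allP P_all : all P (allpairs pair (iota 0 21) (iota 0 21)) by vm_compute.
move=> lt_x lt_y xy; exists (explore 121 [::] [:: (x, y)]).
apply: (implyP (P_all (x, y) _) xy).
by apply: allpairs_f; rewrite mem_iota.
Qed.

Lemma nonrep_color21 : nonrep 21 color21.
Proof.
move=> [//|x a] [|y b] _; first by rewrite /=.
rewrite all_cat => /andP[/= /andP[lt_x lt_a] /= /andP[lt_y lt_b]].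
rewrite /= cat_path /= => /and3P[a_walk ab_adj b_walk].
apply/negP => /andP[xy ab_twin].
have [s /and3P[xy_s /allP s_next /allP s_nadj]] := color21_separated lt_x lt_y xy.
have /s_nadj : (last x a, last y b) \in s; last by rewrite ab_adj.
apply: (@pair_path_invariant color21 21 (mem s)) => // u v u' v' uv_s uu' vv'.
move=> lt_u lt_v uv_twin; have /allP/(_ (u', v')) := s_next _ uv_s; apply.
rewrite mem_filter; apply/andP; split; first by apply/and3P.
by apply: allpairs_f; rewrite !inE /=;
  [case/orP: uu'|case/orP: vv'] => /eqP <-; rewrite eqxx ?orbT.
Qed.

(** * Four colors *)

(** Parity of the binary digit sum of [n]; [k] is fuel, and [n] halvings always suffice. *)
Fixpoint tm_rec (k n : nat) : bool :=
  if k is k'.+1 then odd n (+) tm_rec k' n./2 else false.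

Definition thue_morse (n : nat) : bool := tm_rec n n.

Lemma thue_morse_half n : thue_morse n = odd n (+) thue_morse n./2.
Proof.
have fuel k m : m <= k -> tm_rec k m = tm_rec m m.
  elim/ltn_ind: k m => -[|k] IHk [|m] //= le_mk.
    by rewrite (IHk k) // ; lia.
  congr (_ (+) _); case: m le_mk => [|m] le_mk; first by rewrite (IHk k).
  by rewrite (IHk k) ?(IHk m.+1) //; lia.
by case: n => // n; rewrite /thue_morse [LHS]/= (fuel n) //; lia.
Qed.

Lemma thue_morse_double n : thue_morse n.*2 = thue_morse n.
Proof. by rewrite thue_morse_half odd_double doubleK. Qed.

Lemma thue_morse_doubleS n : thue_morse n.*2.+1 = ~~ thue_morse n.
Proof. by rewrite thue_morse_half /= odd_double uphalf_double. Qed.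

Lemma thue_morse_overlap_free i p : 0 < p ->
  ~ (forall j, j <= p -> thue_morse (i + j) = thue_morse (i + j + p)).
Proof.
elim/ltn_ind: p i => p IHp i p_gt0 ovl.
case: (boolP (odd p)) => p_odd; last first.
  (* For even [p], the positions of the same parity as [i] carry an overlap of half the period. *)
  apply: (IHp p./2 _ i./2); [lia|lia|] => j le_j.
  have /ovl : j.*2 <= p by lia.
  case: (boolP (odd i)) => i_odd.
    rewrite (_ : i + j.*2 = (i./2 + j).*2.+1); last lia.
    rewrite (_ : _ + p = (i./2 + j + p./2).*2.+1); last lia.
    by rewrite !thue_morse_doubleS => /negb_inj.
  rewrite (_ : i + j.*2 = (i./2 + j).*2); last lia.
  rewrite (_ : _ + p = (i./2 + j + p./2).*2); last lia.
  by rewrite !thue_morse_double.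
(* The word alternates on [i + p, i + 2p]: a step from an even position always
   changes the letter, and so does a step from an odd position, because that
   step is a copy of the one from an even position p places earlier. *)
have even_step m : ~~ odd m -> thue_morse m.+1 = ~~ thue_morse m.
  by move=> m_even; rewrite (_ : m = m./2.*2) ?thue_morse_doubleS
    ?thue_morse_double //; lia.
have alt j : j <= p -> thue_morse (i + j + p) = odd j (+) thue_morse (i + p).
  elim: j => [|j IHj] lt_jp; first by rewrite addn0.
  rewrite /= addNb -IHj 1?ltnW // addnS addSn.
  case: (boolP (odd (i + j + p))) => par; last exact: even_step.
  rewrite -(ovl j) 1?ltnW // -addSn -addnS -ovl // addnS even_step //; lia.
(* An odd number of changes separates positions [i + p] and [i + 2p], yet the overlap makes their
   letters equal. *)
have := alt p (leqnn p); rewrite p_odd -ovl // => /=.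
by case: (thue_morse _).
Qed.

(* The difference of consecutive letters of the Thue-Morse word, plus 1. *)
Definition ternary (i : nat) : nat := (thue_morse i.+1).+1 - thue_morse i.

(** Summing differences, [t (i + j + p) - t (i + j)] is the same for all [j <= p]. Its values at
    [j = 0] and [j = p] are two successive equal increments of a 0-1 sequence, hence zero, so the
    square lifts to an overlap. *)
Lemma ternary_square_free i p : 0 < p ->
  ~ (forall j, j < p -> ternary (i + j) = ternary (i + j + p)).
Proof.
move=> p_gt0 sq; pose t k : nat := thue_morse k.
have t_le k : t k <= 1 by rewrite /t; case: (thue_morse k).
have shift j : j <= p -> t (i + j + p) + t i = t (i + j) + t (i + p).
  elim: j => [|j IHj] lt_jp; first by rewrite addn0 addnC.
  have := sq j lt_jp; have := IHj (ltnW lt_jp).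
  rewrite /ternary addnS addSn -!/(t _).
  have := t_le (i + j); have := t_le (i + j).+1.
  by have := t_le (i + j + p); have := t_le (i + j + p).+1; lia.
have eq_t : t (i + p) = t i.
  have := shift p (leqnn p); have := t_le (i + p).
  by have := t_le i; have := t_le (i + p + p); lia.
apply: (@thue_morse_overlap_free i p) => // j le_jp.
have := shift j le_jp; rewrite eq_t /t => /eqP; rewrite eqn_add2r => /eqP.
by case: (thue_morse _); case: (thue_morse _).
Qed.

(** * The square-free word on four letters *)

Definition color4 (i : nat) : nat :=
  if i %% 3 == 2 then 3 else ternary ((i %/ 3).*2 + i %% 3).

Lemma ternary_lt3 i : ternary i < 3.
Proof. by rewrite /ternary; case: (thue_morse i); case: (thue_morse i.+1). Qed.

Lemma color4_eq3 i : (color4 i == 3) = (i %% 3 == 2).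
Proof.
rewrite /color4; case: ifP => // _.
by apply/eqP => eq3; have := ternary_lt3 ((i %/ 3).*2 + i %% 3); rewrite eq3.
Qed.

Lemma ternary_neqS i : ternary i != ternary i.+1.
Proof.
apply/eqP => eq_i; apply: (@ternary_square_free i 1) => // -[|//] _.
by rewrite addn0 addn1.
Qed.

Lemma color4_neqS i : color4 i != color4 i.+1.
Proof.
case: (boolP ((i %% 3 == 2) || (i.+1 %% 3 == 2))) => mod2.
  apply/eqP => eq_i; have := color4_eq3 i; rewrite eq_i color4_eq3; lia.
rewrite /color4 !ifN; try lia.
rewrite (_ : (i.+1 %/ 3).*2 + i.+1 %% 3 = ((i %/ 3).*2 + i %% 3).+1); last lia.
exact: ternary_neqS.
Qed.

(** If neither letter is 3, they surround an inserted 3 and are consecutive in [ternary]. *)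
Lemma color4_neqSS i : color4 i != color4 i.+2.
Proof.
case: (boolP ((i %% 3 == 2) || (i.+2 %% 3 == 2))) => mod2.
  apply/eqP => eq_i; have := color4_eq3 i; rewrite eq_i color4_eq3; lia.
rewrite /color4 !ifN; try lia.
rewrite (_ : (i.+2 %/ 3).*2 + i.+2 %% 3 = ((i %/ 3).*2 + i %% 3).+1); last lia.
exact: ternary_neqS.
Qed.

Lemma color4_square_free i p : 0 < p ->
  ~ (forall j, j < p -> color4 (i + j) = color4 (i + j + p)).
Proof.
move=> p_gt0 sq.
case: (ltnP p 3) => [lt_p3|le_3p].
  have := sq 0 p_gt0; rewrite addn0.
  have [->|->] : p = 1 \/ p = 2 by lia.
    by rewrite addn1 => /eqP; rewrite (negPf (color4_neqS i)).
  by rewrite addn2 => /eqP; rewrite (negPf (color4_neqSS i)).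
have p_mod3 : p %% 3 = 0.
  (* This offset leads to the first 3 at or after [i]; its copy [p] places later is also a 3, so 3
     divides [p]. *)
  have lt_j : (2 + 2 * (i %% 3)) %% 3 < p by lia.
  have := color4_eq3 (i + (2 + 2 * (i %% 3)) %% 3).
  by rewrite (sq _ lt_j) color4_eq3; lia.
apply: (@ternary_square_free ((i %/ 3).*2 + i %% 3) (p %/ 3).*2); first lia.
move=> j lt_j; set u := _ + j.
(* Letter [u] of [ternary] sits at position [3 * u./2 + odd u] of [color4]. Deleting the 3s leaves a
   square of period [2p/3]. *)
have lt_m : 3 * u./2 + odd u - i < p by rewrite /u; lia.
have := sq _ lt_m; rewrite subnKC; last by rewrite /u; lia.
rewrite /color4 !ifN; try lia.
rewrite (_ : _ + (3 * u./2 + odd u) %% 3 = u); last lia.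
by rewrite (_ : _ + (3 * u./2 + odd u + p) %% 3 = u + (p %/ 3).*2); last lia.
Qed.

(** * From words to walks *)

Lemma adj_ivt (A : nat -> nat) m z :
  (forall i, i < m -> adj (A i) (A i.+1)) ->
  (A 0 <= z <= A m) || (A m <= z <= A 0) -> exists2 i, i <= m & A i = z.
Proof.
elim: m => [|m IHm] A_step z_btw; first by exists 0 => //; lia.
case: (eqVneq (A m.+1) z) => [<-|neq_z]; first by exists m.+1.
have [||i le_im <-] := IHm; last by exists i => //; apply: leqW.
  by move=> i lt_im; apply: A_step; apply: ltnW.
by have := A_step m (leqnn _); rewrite /adj; lia.
Qed.

Lemma nonrep_square_palindrome_free n (f : nat -> nat) :
  (forall i, f i != f i.+1) -> (forall i, f i != f i.+2) ->
  (forall i p, 0 < p -> ~ (forall j, j < p -> f (i + j) = f (i + j + p))) ->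
  nonrep n f.
Proof.
move=> f_neqS f_neqSS f_sqf [//|x a] [|y b] _ _; first by rewrite /=.
rewrite /= cat_path /= => /and3P[/(pathP 0) a_walk ab_adj /(pathP 0) b_walk].
apply/negP => /(all2_nthP 0 0 _ (x :: a) (y :: b))[/= [sz_ab] ab_twin].
pose m := size a; pose A := nth 0 (x :: a); pose B := nth 0 (y :: b).
have A_step i : i < m -> adj (A i) (A i.+1) by apply: a_walk.
have B_step i : i < m -> adj (B i) (B i.+1) by rewrite /m sz_ab; apply: b_walk.
have f_eq i : i <= m -> f (A i) = f (B i).
  by move=> le_im; have /andP[_ /eqP] := ab_twin i le_im.
have AB_neq i : i <= m -> A i != B i by move=> /ab_twin/andP[].
have AB_adj : adj (A m) (B 0) by rewrite /A /m nth_last.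
have f_adj u v : adj u v -> f u != f v.
  by case/orP=> /eqP <-; rewrite // eq_sym.
(* Without factors [xyx], equal colors two steps apart on a walk mean that it turned back. *)
have f_turn u v w : adj u v -> adj v w -> f u = f w -> u = w.
  move=> uv vw eq_f; apply/eqP/negPn/negP => neq_uw.
  have [Ew|Eu] : w = u.+2 \/ u = w.+2 by move: uv vw; rewrite /adj; lia.
    by have := f_neqSS u; rewrite -Ew eq_f eqxx.
  by have := f_neqSS w; rewrite -Eu eq_f eqxx.
move: {a_walk b_walk ab_twin ab_adj sz_ab} m A B A_step B_step f_eq AB_neq AB_adj.
move=> m A B A_step B_step f_eq AB_neq AB_adj.
(* The first step decides between constant difference and constant sum; by [f_turn] both walks later
   turn back at the same times, which preserves either. *)
have [par|mir] : (forall i, i <= m -> A i + B 0 = B i + A 0) \/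
                 (forall i, i <= m -> A i + B i = A 0 + B 0).
  elim: m A_step B_step f_eq {AB_neq AB_adj} => [|m IHm] A_step B_step f_eq.
    by left=> i; rewrite leqn0 => /eqP ->; rewrite addnC.
  case: m => [|m] in IHm A_step B_step f_eq *.
    have := A_step 0 isT; have := B_step 0 isT; rewrite /adj => B01 A01.
    case: (eqVneq (A 1 + B 0) (B 1 + A 0)) => E.
      by left=> -[|[|]] // _; lia.
    by right=> -[|[|]] // _; lia.
  have turn : A m.+2 = A m <-> B m.+2 = B m.
    split=> E; apply/esym/f_turn; try exact: B_step; try exact: A_step.
      by rewrite -!f_eq ?E // ltnW.
    by rewrite !f_eq ?E // ltnW.
  have := A_step m (ltnW (leqnn _)); have := A_step m.+1 (leqnn _).
  have := B_step m (ltnW (leqnn _)); have := B_step m.+1 (leqnn _).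
  rewrite /adj => B2 B1 A2 A1.
  have [||| IH|IH] := IHm.
  - by move=> i /ltnW; apply: A_step.
  - by move=> i /ltnW; apply: B_step.
  - by move=> i /leqW; apply: f_eq.
  - left=> i; rewrite leq_eqVlt => /predU1P[->|]; last exact: IH.
    by have := IH m (leqnSn _); have := IH m.+1 (leqnn _); lia.
  right=> i; rewrite leq_eqVlt => /predU1P[->|]; last exact: IH.
  by have := IH m (leqnSn _); have := IH m.+1 (leqnn _); lia.
(* Parallel walks: [A] travels from [A 0] to a neighbor of [B 0], so it sweeps a full period of
   length [|A 0 - B 0|]. *)
- have := AB_neq 0 isT; have := AB_adj; have := par m (leqnn _).
  rewrite /adj => par_m AB_m AB_0.
  case: (ltnP (A 0) (B 0)) => lt_AB.
    apply: (f_sqf (A 0) (B 0 - A 0)) => [|j lt_j]; first lia.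
    have [|i le_im Ai] := @adj_ivt A m (A 0 + j) A_step; first lia.
    rewrite -Ai f_eq //; congr f; have := par i le_im; lia.
  have ivt j : j < A 0 - B 0 -> exists2 i, i <= m & A i = (B 0).+1 + j.
    by move=> lt_j; apply: adj_ivt => //; lia.
  (* At time [i0] the walk [B] is at [(B 0).*2.+1 - A 0], so this subtraction does not truncate; the
     square starts there. *)
  have [|i0 le_i0m Ai0] := ivt 0; first lia.
  have := par i0 le_i0m => par_i0.
  apply: (f_sqf ((B 0).*2.+1 - A 0) (A 0 - B 0)) => [|j lt_j]; first lia.
  have [i le_im Ai] := ivt j lt_j.
  have := par i le_im => par_i.
  rewrite (_ : _ + (A 0 - B 0) = A i) ?f_eq //; last lia.
  by congr f; lia.
(* Mirrored walks: equal colors keep them at distance at least two, and one step of both changes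
   their difference by at most two, so they cannot swap sides. *)
have gap i : i <= m -> (A i).+1 < B i \/ (B i).+1 < A i.
  move=> le_im; have neq_i := AB_neq i le_im.
  have : ~~ adj (A i) (B i) by apply: contraL (introT eqP (f_eq i le_im)) => /f_adj.
  by rewrite /adj; lia.
have same_side i : i <= m -> (A 0 < B 0) = (A i < B i).
  elim: i => // i IHi lt_im; rewrite IHi ?(ltnW lt_im) //.
  have := gap i (ltnW lt_im); have := gap i.+1 lt_im.
  by have := A_step i lt_im; have := B_step i lt_im; rewrite /adj; lia.
(* [A m] is next to [B 0], so by reflection [B m] is next to [A 0]: the walks would have met or
   swapped sides. *)
have := same_side m (leqnn _); have := mir m (leqnn _); have := AB_adj.
by have := gap 0 isT; have := gap m (leqnn _); rewrite /adj; lia.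
Qed.

Theorem theorem2 (n : nat) (hn : 4 <= n) :
  (n <= 21 -> rho (path_graph n) = 3) /\ (22 <= n -> rho (path_graph n) = 4).
Proof.
split=> hn'; apply: rho_path_eq.
- exists color21; split; last exact: nonrep_leq hn' nonrep_color21.
  move=> i lt_in; have: all (gtn 3) word21 by [].
  by move/(all_nthP 0); apply; apply: leq_trans hn'.
- move=> f f_lt /(nonrep_leq hn); apply: nonrep4_gt2 => i lt_i.
  by apply: f_lt; apply: leq_trans hn.
- exists color4; split.
    move=> i _; rewrite /color4; case: ifP => // _.
    by apply: ltnW; apply: ternary_lt3.
  apply: nonrep_square_palindrome_free.
  + exact: color4_neqS.
  + exact: color4_neqSS.
  + exact: color4_square_free.
- move=> f f_lt /(nonrep_leq hn'); apply: nonrep22_gt3 => i lt_i.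
  by apply: f_lt; apply: leq_trans hn'.
Qed.
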